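(* Let $n\ge 1$ and $m\ge 1$ be integers and let $H_m(\mathbb B)$ be the analytic functional Hilbert space on the open unit ball $\mathbb B\subset\mathbb C^n$ with reproducing kernel $K_m(z,w)=(1-\langle z,w\rangle)^{-m}$. Let $g,h\in H_m(\mathbb B)$ and let $T\in L(H_m(\mathbb B))$ be a bounded Toeplitz operator with pluriharmonic symbol $f=g+\overline h$, i.e. $Tp=T_gp+T_h^*p$ for all $p\in\mathbb C[z]$. Then \[ M^{\prime *}_zTM^\prime_z = P_{{\rm Im}M^*_z}\Big(\oplus \sum^{m-1}_{j=0}(-1)^j\binom{m}{j+1}\sigma^j_{M_z}(T)\Big)P_{{\rm Im}M^*_z}. \]
   Context: $H_m(\mathbb B)=\{f=\sum_{\alpha\in\mathbb N^n}f_\alpha z^\alpha\in\mathcal O(\mathbb B):\ \|f\|^2=\sum_\alpha |f_\alpha|^2/\rho_m(\alpha)<\infty\}$ with $\rho_m(\alpha)=\frac{(m+|\alpha|-1)!}{\alpha!(m-1)!}$; the monomials are orthogonal and polynomials are dense. Let $\mathbb H_k$ denote the space of homogeneous polynomials of degree $k$, so $H_m(\mathbb B)$ is the orthogonal sum of the $\mathbb H_k$, and every $f$ has homogeneous expansion $f=\sum_k f_k$, $f_k\in\mathbb H_k$. $M_z:H_m(\mathbb B)^n\to H_m(\mathbb B)$, $(f_i)\mapsto\sum_i z_if_i$, is the row multiplication operator (it has closed range), $M_z^*:H_m(\mathbb B)\to H_m(\mathbb B)^n$, $f\mapsto (M_{z_i}^*f)_i$, is its adjoint, and $P_{{\rm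 Im}M_z^*}$ is the orthogonal projection of $H_m(\mathbb B)^n$ onto the closed range of $M_z^*$. Let $\delta\in L(H_m(\mathbb B))$ be the diagonal operator $\delta(\sum_k f_k)=f_0+\sum_{k\ge1}\frac{m+k-1}{k}f_k$, and define $M_z'=\delta M_z:H_m(\mathbb B)^n\to H_m(\mathbb B)$, with adjoint $M_z'^*$. For $X\in L(H_m(\mathbb B))$, $\sigma_{M_z}(X)=\sum_{i=1}^n M_{z_i}XM_{z_i}^*$, $\sigma^j_{M_z}$ is its $j$-th iterate ($\sigma^0_{M_z}(X)=X$), and $\oplus X$ denotes $X\oplus\cdots\oplus X$ ($n$ copies) on $H_m(\mathbb B)^n$. For $u\in H_m(\mathbb B)$, $T_u$ denotes the densely defined closed multiplication operator $D_u\to H_m(\mathbb B)$, $v\mapsto uv$, with domain $D_u=\{v\in H_m(\mathbb B): uv\in H_m(\mathbb B)\}\supset\mathbb C[z]$, and $T_u^*$ its Hilbert space adjoint; the polynomials lie in the domain of $T_u^*$ and $T_u^*z^\alpha=\sum_{0\le\beta\le\alpha}\frac{\rho_m(\alpha-\beta)}{\rho_m(\alpha)}\overline{u_\beta}z^{\alpha-\beta}$. A bounded operator $T$ on $H_m(\mathbb B)$ is called a Toeplitz operator with pluriharmonic symbol $f$ if there are $g,h\in H_m(\mathbb B)$ with $f=g+\overline h$ and $Tp=T_gp+T_h^*p$ for all $p\in\mathbb C[z]$. *)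

(* Defs.v *)
From HB Require Import structures.
From mathcomp Require Import all_boot all_algebra.
From mathcomp Require Import complex.
From mathcomp Require Import boolp classical_sets functions reals topology normedtype sequences.
From Stdlib Require Import ClassicalEpsilon.
Set Implicit Arguments. Unset Strict Implicit. Unset Printing Implicit Defensive.
Import GRing.Theory Num.Theory numFieldNormedType.Exports.
Local Open Scope classical_set_scope.
Local Open Scope ring_scope.

Section Hm.
Variables (R : realType) (n m : nat).
Local Notation C := R[i].

Definition mi := {ffun 'I_n -> nat}.
Definition deg (a : mi) : nat := (\sum_(i < n) a i)%N.
Definition mfact (a : mi) : nat := (\prod_(i < n) (a i)`!)%N.
(** rho_m(alpha) = (m+|alpha|-1)! / (alpha! (m-1)!)  (an exact division) *)
Definition rho (a : mi) : nat := ((m + deg a - 1)`! %/ (mfact a * (m - 1)`!))%N.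

(** The coefficient sequences: f = sum_alpha f_alpha z^alpha *)
Definition Hsp := mi -> C.
Definition Hnsp := 'I_n -> Hsp.

Definition abs2 (z : C) : R := complex.Re z ^+ 2 + complex.Im z ^+ 2.

Definition of_box N (b : {ffun 'I_n -> 'I_N}) : mi := [ffun i => nat_of_ord (b i)].

Definition wsq (f : Hsp) (N : nat) : R :=
  \sum_(b : {ffun 'I_n -> 'I_N}) abs2 (f (of_box b)) / (rho (of_box b))%:R.

Definition inH (f : Hsp) : Prop := exists B : R, forall N, wsq f N <= B.

Definition normsq (f : Hsp) : R := lim (wsq f @ \oo).

Definition ipsum (f g : Hsp) (N : nat) : C :=
  \sum_(b : {ffun 'I_n -> 'I_N}) f (of_box b) * conjc (g (of_box b)) / (rho (of_box b))%:R.

Definition ip (f g : Hsp) : C :=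
  Complex (lim ((fun N => complex.Re (ipsum f g N)) @ \oo))
          (lim ((fun N => complex.Im (ipsum f g N)) @ \oo)).

Definition inHn (F : Hnsp) : Prop := forall i, inH (F i).
Definition ipn (F G : Hnsp) : C := \sum_(i < n) ip (F i) (G i).
Definition normsqn (F : Hnsp) : R := \sum_(i < n) normsq (F i).

Definition bounded_op (A : Hsp -> Hsp) : Prop :=
  (forall f, inH f -> inH (A f)) /\
  (forall (c : C) f g, inH f -> inH g -> A (fun a => c * f a + g a) = (fun a => c * A f a + A g a)) /\
  (exists c : R, forall f, inH f -> normsq (A f) <= c * normsq f).

(** Hilbert space adjoints (chosen by classical choice; determined on the space) *)
Definition is_adj_HH (A B : Hsp -> Hsp) : Prop :=
  (forall f, inH f -> inH (B f)) /\
  (forall f g, inH f -> inH g -> ip (A f) g = ip f (B g)).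
Definition adj_HH (A : Hsp -> Hsp) : Hsp -> Hsp :=
  epsilon (inhabits (fun f => f)) (is_adj_HH A).

Definition is_adj_HnH (A : Hnsp -> Hsp) (B : Hsp -> Hnsp) : Prop :=
  (forall f, inH f -> inHn (B f)) /\
  (forall F g, inHn F -> inH g -> ip (A F) g = ipn F (B g)).
Definition adj_HnH (A : Hnsp -> Hsp) : Hsp -> Hnsp :=
  epsilon (inhabits (fun _ _ _ => 0)) (is_adj_HnH A).

Definition sube (a : mi) (i : 'I_n) : mi := [ffun j => if j == i then (a j).-1 else a j].
Definition Mzi (i : 'I_n) (f : Hsp) : Hsp :=
  fun a => if (0 < a i)%N then f (sube a i) else 0.
Definition Mzi_adj (i : 'I_n) : Hsp -> Hsp := adj_HH (Mzi i).
Definition Mz (F : Hnsp) : Hsp := fun a => \sum_(i < n) Mzi i (F i) a.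
Definition Mz_adj (f : Hsp) : Hnsp := fun i => Mzi_adj i f.

Definition delta (f : Hsp) : Hsp :=
  fun a => if deg a == 0%N then f a
           else ((m + deg a - 1)%:R / (deg a)%:R) * f a.
Definition Mzp (F : Hnsp) : Hsp := delta (Mz F).
Definition Mzp_adj : Hsp -> Hnsp := adj_HnH Mzp.

Definition sigmaMz (X : Hsp -> Hsp) : Hsp -> Hsp :=
  fun f a => \sum_(i < n) Mzi i (X (Mzi_adj i f)) a.

Definition oplus (X : Hsp -> Hsp) : Hnsp -> Hnsp := fun F i => X (F i).

Definition rangeMz_adj : set Hnsp := [set F | exists f, inH f /\ F = Mz_adj f].
Definition closure_Hn (V : set Hnsp) : set Hnsp :=
  [set F | inHn F /\ forall e : R, 0 < e ->
     exists G, V G /\ normsqn (fun i a => F i a - G i a) < e].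
Definition is_orth_proj (V : set Hnsp) (P : Hnsp -> Hnsp) : Prop :=
  forall F, inHn F -> V (P F) /\
    forall G, V G -> ipn (fun i a => F i a - P F i a) G = 0.
Definition orth_proj (V : set Hnsp) : Hnsp -> Hnsp :=
  epsilon (inhabits (fun F => F)) (is_orth_proj V).
Definition P_ImMz_adj : Hnsp -> Hnsp := orth_proj (closure_Hn rangeMz_adj).

Definition is_poly (p : Hsp) : Prop := exists N, forall a, (N <= deg a)%N -> p a = 0.

Definition subm (a b : mi) : mi := [ffun i => (a i - b i)%N].
Definition mulH (u v : Hsp) : Hsp :=
  fun a => \sum_(b : {ffun 'I_n -> 'I_(deg a).+1} | [forall i, (b i <= a i)%N])
             u (of_box b) * v (subm a (of_box b)).

Definition in_dom_Tu (u v : Hsp) : Prop := inH v /\ inH (mulH u v).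
(** w = T_u^* v  (Hilbert space adjoint of the densely defined operator T_u) *)
Definition is_Tu_adj_val (u v w : Hsp) : Prop :=
  inH v /\ inH w /\ forall x, in_dom_Tu u x -> ip (mulH u x) v = ip x w.

Definition toeplitz_pluriharmonic (T : Hsp -> Hsp) (g h : Hsp) : Prop :=
  bounded_op T /\ inH g /\ inH h /\
  forall p, is_poly p -> exists w, is_Tu_adj_val h p w /\
     T p = (fun a => mulH g p a + w a).

Definition Sop (T : Hsp -> Hsp) : Hsp -> Hsp :=
  fun f a => \sum_(j < m) ((-1) ^+ j * ('C(m, j.+1))%:R) * iter j sigmaMz T f a.

End Hm.

(* Main.v *)
Require Import Defs.
From HB Require Import structures.
From mathcomp Require Import all_boot all_order all_algebra.
From mathcomp Require Import complex.
From mathcomp Require Import boolp classical_sets functions reals topology normedtype sequences.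
From mathcomp Require Import ring lra.
From Stdlib Require Import ClassicalEpsilon.
Set Implicit Arguments. Unset Strict Implicit. Unset Printing Implicit Defensive.
Import Order.TTheory GRing.Theory Num.Theory numFieldNormedType.Exports.
Local Open Scope ring_scope.

(** [M_z M_z^*] is the diagonal operator with eigenvalue [k / (m + k - 1)] in degree [k], so
[delta M_z M_z^*] is the projection off the constants, [P_{Im M_z^*} = M_z^* delta M_z] and
[M_z'^* = M_z^* delta].  Both sides of the theorem thus have the form
[M_z^* delta (-) delta M_z], and the theorem says that
[sum_{j <= m} (-1)^j C(m,j) sigma^j(T)] has no matrix coefficient off the constants.

On polynomials [T = T_g + T_h^*]; [T_g] commutes with the [M_{z_i}] and [T_h^*] with the
[M_{z_i}^*], so [sigma^j(T) p = T_g sigma^j(I) p + sigma^j(I) T_h^* p].  The operator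
[sigma^j(I)] is diagonal with eigenvalue [C(m+k-1-j, m-1) / C(m+k-1, m-1)] in degree [k], and
for [k >= 1] the alternating sum of these vanishes, being an [m]-th difference of a polynomial
of degree [m - 1].  Density of the polynomials and boundedness of [T] extend this to [H_m]. *)

(** * Multi-indices, finite boxes of them, and the weights [rho] *)

Section MultiIndex.
Variable n : nat.
Implicit Types (a b : mi n) (i : 'I_n) (s : seq (mi n)).

Definition adde a i : mi n := [ffun j => if j == i then (a j).+1 else a j].

Lemma addeK i : cancel (adde^~ i) (@sube n ^~ i).
Proof. by move=> a; apply/ffunP => j; rewrite !ffunE; case: eqP. Qed.

Lemma subeK a i : (0 < a i)%N -> adde (sube a i) i = a.
Proof.
move=> ai; apply/ffunP => j; rewrite !ffunE; case: eqP => // ->.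
by rewrite prednK.
Qed.

Lemma adde_ii a i : adde a i i = (a i).+1.
Proof. by rewrite ffunE eqxx. Qed.

Lemma sube_ii a i : sube a i i = (a i).-1.
Proof. by rewrite ffunE eqxx. Qed.

Lemma deg_adde a i : deg (adde a i) = (deg a).+1.
Proof.
rewrite /deg (bigD1 i) //= [in RHS](bigD1 i) //= adde_ii addSn.
by congr (_ + _).+1; apply: eq_bigr => j /negbTE ji; rewrite ffunE ji.
Qed.

Lemma deg_sube a i : (0 < a i)%N -> deg (sube a i) = (deg a).-1.
Proof. by move=> ai; rewrite -{2}(subeK ai) deg_adde. Qed.

Lemma le_deg a i : (a i <= deg a)%N.
Proof. by rewrite /deg (bigD1 i) //= leq_addr. Qed.

Lemma mfact_adde a i : mfact (adde a i) = ((a i).+1 * mfact a)%N.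
Proof.
rewrite /mfact (bigD1 i) //= [in RHS](bigD1 i) //= adde_ii factS mulnA.
by congr (_ * _)%N; apply: eq_bigr => j /negbTE ji; rewrite ffunE ji.
Qed.

Lemma mfact_gt0 a : (0 < mfact a)%N.
Proof. by rewrite prodn_gt0 // => i; rewrite fact_gt0. Qed.

Lemma dvdn_factM (x y : nat) : (x`! * y`! %| (x + y)`!)%N.
Proof.
rewrite -(bin_fact (leq_addr y x)) addKn.
exact: dvdn_mull.
Qed.

Lemma mfact_dvd a : (mfact a %| (deg a)`!)%N.
Proof.
rewrite /mfact /deg; elim: (index_enum _) => [|i s IHs].
  by rewrite !big_nil.
rewrite !big_cons; apply: dvdn_trans (dvdn_factM _ _).
exact: dvdn_mul.
Qed.

(** The division in [rho] is exact, since $\alpha!$ divides $|\alpha|!$ and $x!\,y!$ divides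
    $(x+y)!$. *)
Lemma rhoK m a : (0 < m)%N ->
  (rho m a * (mfact a * (m - 1)`!))%N = ((m + deg a - 1)`!)%N.
Proof.
move=> m0; rewrite /rho divnK //.
have -> : (m + deg a - 1 = deg a + (m - 1))%N by rewrite addnC addnBA.
apply: dvdn_trans (dvdn_factM _ _).
by rewrite dvdn_mul // mfact_dvd.
Qed.

Lemma rho_gt0 m a : (0 < m)%N -> (0 < rho m a)%N.
Proof.
move/(rhoK a); case: rho => //; rewrite mul0n => /esym/eqP.
by rewrite -leqn0 leqNgt fact_gt0.
Qed.

(** Passing to $\alpha+e_i$ multiplies the numerator by $m+|\alpha|$ and the denominator by
    $\alpha_i+1$. All weight ratios of the shifts come from this recurrence. *)
Lemma rho_adde m a i : (0 < m)%N ->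
  (rho m (adde a i) * (a i).+1 = rho m a * (m + deg a))%N.
Proof.
move=> m0; apply/eqP; have k0 : (0 < mfact a * (m - 1)`!)%N by rewrite muln_gt0 mfact_gt0 fact_gt0.
rewrite -(eqn_pmul2r k0) -mulnA [((a i).+1 * _)%N]mulnA -mfact_adde rhoK //.
rewrite [(rho m a * _)%N]mulnC -mulnA rhoK // deg_adde; apply/eqP.
rewrite addnS subn1 /= -[X in X`! = _]prednK ?addn_gt0 ?m0 // factS prednK ?addn_gt0 ?m0 //.
by rewrite -subn1 mulnC.
Qed.

Lemma of_box_inj N : injective (@of_box n N).
Proof.
move=> b c /ffunP bc; apply/ffunP => i; apply: val_inj.
by have := bc i; rewrite !ffunE.
Qed.

Definition box N : seq (mi n) := [seq of_box b | b : {ffun 'I_n -> 'I_N}].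

Lemma box_uniq N : uniq (box N).
Proof. by rewrite map_inj_uniq ?enum_uniq //; exact: of_box_inj. Qed.

Lemma mem_box N a : (a \in box N) = [forall i, (a i < N)%N].
Proof.
apply/mapP/forallP => [[b _ ->] i|aN]; first by rewrite ffunE.
exists [ffun i => Ordinal (aN i)]; first by rewrite mem_enum.
by apply/ffunP => i; rewrite !ffunE.
Qed.

(** Turns the sums over finite functions in the definitions into sums over duplicate-free lists,
    which can be compared by inclusion. *)
Lemma big_box (V : nmodType) N (P : pred (mi n)) (F : mi n -> V) :
  \sum_(b : {ffun 'I_n -> 'I_N} | P (of_box b)) F (of_box b)
  = \sum_(a <- box N | P a) F a.
Proof. by rewrite /box big_image_cond. Qed.

Lemma box_deg N a : (deg a < N)%N -> a \in box N.
Proof. by move=> aN; rewrite mem_box; apply/forallP => i; apply: leq_ltn_trans (le_deg a i) aN. Qed.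

Lemma sub_boxW N M : (N <= M)%N -> {subset box N <= box M}.
Proof.
move=> NM a; rewrite !mem_box => /forallP aN; apply/forallP => i.
exact: leq_trans (aN i) NM.
Qed.

Lemma sub_box s : exists N, {subset s <= box N}.
Proof.
elim: s => [|a s [N sN]]; first by exists 0%N.
exists (maxn (deg a).+1 N) => b; rewrite inE => /predU1P[->|/sN].
  by apply: box_deg; rewrite leq_maxl.
by apply: sub_boxW; rewrite leq_maxr.
Qed.

End MultiIndex.

(** * Squared modulus of complex numbers *)

Section Abs2.
Variable R : realType.
Implicit Types x y : R[i].

Lemma abs2_ge0 x : 0 <= abs2 x.
Proof. by rewrite /abs2 addr_ge0 ?sqr_ge0. Qed.

Lemma abs2M x y : abs2 (x * y) = abs2 x * abs2 y.
Proof. by case: x y => [a b] [c d]; rewrite /abs2 /=; ring. Qed.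

Lemma abs2N x : abs2 (- x) = abs2 x.
Proof. by case: x => [a b]; rewrite /abs2 /= !sqrrN. Qed.

Lemma abs2D x y : abs2 (x + y) <= 2 * abs2 x + 2 * abs2 y.
Proof.
case: x y => [a b] [c d]; rewrite /abs2 /= -subr_ge0.
have -> : 2 * (a ^+ 2 + b ^+ 2) + 2 * (c ^+ 2 + d ^+ 2) - ((a + c) ^+ 2 + (b + d) ^+ 2)
  = (a - c) ^+ 2 + (b - d) ^+ 2 by ring.
by rewrite addr_ge0 ?sqr_ge0.
Qed.

Lemma abs20 : abs2 (0 : R[i]) = 0.
Proof. by rewrite /abs2 /= expr0n addr0. Qed.

Lemma abs2_eq0 x : abs2 x = 0 -> x = 0.
Proof.
case: x => [a b]; rewrite /abs2 /= => /eqP.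
by rewrite paddr_eq0 ?sqr_ge0 // !sqrf_eq0 => /andP[/eqP-> /eqP->].
Qed.

Lemma abs2_real (r : R) : abs2 (r%:C)%C = r ^+ 2.
Proof. by rewrite /abs2 /= expr0n addr0. Qed.

Lemma natC k : (k%:R : R[i]) = ((k%:R : R)%:C)%C.
Proof. by rewrite rmorph_nat. Qed.

Lemma divnatC k l : (k%:R / l%:R : R[i]) = ((k%:R / l%:R : R)%:C)%C.
Proof. by rewrite rmorphM fmorphV !rmorph_nat. Qed.

End Abs2.

(** * Membership in the space and the norm, through weighted sums over boxes *)

Section Norm.
Variables (R : realType) (n m : nat).
Hypothesis m_gt0 : (0 < m)%N.
Implicit Types (f g u v : Hsp R n) (a b : mi n) (s : seq (mi n)).
Local Notation inH := (@inH R n m).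
Local Notation normsq := (@normsq R n m).
Local Notation bounded_op := (@bounded_op R n m).

Local Notation W f a := (abs2 (f a) / (rho m a)%:R).

Lemma rhoR_gt0 a : 0 < (rho m a)%:R :> R.
Proof. by rewrite ltr0n rho_gt0. Qed.

Lemma W_ge0 f a : 0 <= W f a.
Proof. by rewrite divr_ge0 ?abs2_ge0 ?ler0n. Qed.

Lemma wsqE f N : wsq m f N = \sum_(a <- box n N) W f a.
Proof. by rewrite -big_box. Qed.

Lemma ler_sum_sub s t (F : mi n -> R) : (forall a, 0 <= F a) -> uniq s -> uniq t ->
  {subset s <= t} -> \sum_(a <- s) F a <= \sum_(a <- t) F a.
Proof.
move=> F0 us ut st; rewrite [leRHS](bigID (mem s)) /= -[in leRHS]big_filter.
have -> : \sum_(a <- [seq a <- t | a \in s]) F a = \sum_(a <- s) F a.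
  apply: perm_big; apply: uniq_perm => //; first exact: filter_uniq.
  by move=> a; rewrite mem_filter; case: (boolP (a \in s)) => // /st ->.
by rewrite lerDl sumr_ge0.
Qed.

Lemma wsq_homo f : {homo wsq m f : N M / (N <= M)%N >-> N <= M}.
Proof.
move=> N M NM; rewrite !wsqE; apply: ler_sum_sub; rewrite ?box_uniq //.
  exact: W_ge0.
exact: sub_boxW.
Qed.

Lemma wsq_cvg f : inH f -> cvgn (wsq m f).
Proof.
move=> [B fB]; apply: nondecreasing_is_cvgn; first exact: wsq_homo.
by exists B => _ [N _ <-].
Qed.

Lemma inH_seq_le f s : inH f -> uniq s -> \sum_(a <- s) W f a <= normsq f.
Proof.
move=> Hf us; have [N sN] := sub_box s.
apply: le_trans (nondecreasing_cvgn_le (@wsq_homo f) (wsq_cvg Hf) N).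
by rewrite wsqE; apply: ler_sum_sub; rewrite ?box_uniq //; exact: W_ge0.
Qed.

Lemma normsq_le f B : (forall N, wsq m f N <= B) -> inH f /\ normsq f <= B.
Proof.
move=> fB; have Hf : inH f by exists B.
split=> //; apply: limr_le; first exact: wsq_cvg.
by apply: nearW => N; exact: fB.
Qed.

Lemma normsq_ge0 f : inH f -> 0 <= normsq f.
Proof. by move=> Hf; have := inH_seq_le (s := [::]) Hf isT; rewrite big_nil. Qed.

Lemma coef_le f a : inH f -> abs2 (f a) <= (rho m a)%:R * normsq f.
Proof.
move=> Hf; rewrite mulrC -ler_pdivrMr ?rhoR_gt0 //.
by have := inH_seq_le (s := [:: a]) Hf isT; rewrite big_seq1.
Qed.

Lemma normsq_eq0 f : inH f -> normsq f = 0 -> f = (fun=> 0).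
Proof.
move=> Hf f0; apply/funext => a; apply: abs2_eq0; apply/eqP.
by rewrite eq_le abs2_ge0 andbT; have := coef_le a Hf; rewrite f0 mulr0.
Qed.

(** Injectivity of [phi] on [P] makes the dominating terms distinct terms of the norm of [g]. The
    bounds for the shifts and for $\delta$ all come from this comparison. *)
Lemma reindex_bound f g (c : R) (P : pred (mi n)) (phi : mi n -> mi n) :
  inH g -> 0 <= c -> (forall a, ~~ P a -> f a = 0) -> {in P &, injective phi} ->
  (forall a, P a -> W f a <= c * W g (phi a)) ->
  inH f /\ normsq f <= c * normsq g.
Proof.
move=> Hg c0 f0 phiI fg; apply: normsq_le => N; rewrite wsqE.
have -> : \sum_(a <- box n N) W f a = \sum_(a <- box n N | P a) W f a.
  rewrite (bigID P) /= addrC big1 ?add0r // => a /f0 ->.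
  by rewrite abs20 mul0r.
apply: (@le_trans _ _ (\sum_(a <- box n N | P a) c * W g (phi a))).
  exact: ler_sum.
rewrite -mulr_sumr ler_wpM2l //.
have -> : \sum_(a <- box n N | P a) W g (phi a)
  = \sum_(a <- [seq phi a | a <- [seq a <- box n N | P a]]) W g a.
  by rewrite [RHS]big_map [RHS]big_filter.
apply: inH_seq_le => //; rewrite map_inj_in_uniq ?filter_uniq ?box_uniq //.
by move=> a b; rewrite !mem_filter => /andP[Pa _] /andP[Pb _]; exact: phiI.
Qed.

Lemma lin_bound (c : R[i]) f g : inH f -> inH g ->
  inH (fun a => c * f a + g a) /\
  normsq (fun a => c * f a + g a) <= 2 * abs2 c * normsq f + 2 * normsq g.
Proof.
move=> Hf Hg; apply: normsq_le => N; rewrite wsqE.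
apply: (@le_trans _ _ (2 * abs2 c * \sum_(a <- box n N) W f a
   + 2 * \sum_(a <- box n N) W g a)); last first.
  by rewrite lerD // ler_wpM2l ?mulr_ge0 ?abs2_ge0 // ?inH_seq_le ?box_uniq.
rewrite !mulr_sumr -big_split /=; apply: ler_sum => a _.
rewrite !mulrA -mulrDl ler_pM2r ?invr_gt0 ?rhoR_gt0 //.
by rewrite -mulrA -abs2M abs2D.
Qed.

Lemma inH_lin c f g : inH f -> inH g -> inH (fun a => c * f a + g a).
Proof. by move=> Hf Hg; have [] := lin_bound c Hf Hg. Qed.

Lemma inH0 : inH (fun=> 0).
Proof. by exists 0 => N; rewrite wsqE big1 // => a _; rewrite abs20 mul0r. Qed.

Lemma inHZ c f : inH f -> inH (fun a => c * f a).
Proof.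
move=> Hf; have := inH_lin c Hf inH0.
by congr inH; apply/funext => a; rewrite addr0.
Qed.

Lemma inHD f g : inH f -> inH g -> inH (fun a => f a + g a).
Proof.
move=> Hf Hg; have := inH_lin 1 Hf Hg.
by congr inH; apply/funext => a; rewrite mul1r.
Qed.

Lemma inHB f g : inH f -> inH g -> inH (fun a => f a - g a).
Proof.
move=> Hf Hg; have := inH_lin (-1) Hg Hf.
by congr inH; apply/funext => a; rewrite mulN1r addrC.
Qed.

Lemma inH_sum (I : Type) (s : seq I) (P : pred I) (F : I -> Hsp R n) :
  (forall i, P i -> inH (F i)) -> inH (fun a => \sum_(i <- s | P i) F i a).
Proof.
move=> HF; elim: s => [|i s IHs].
  by have := inH0; congr inH; apply/funext => a; rewrite big_nil.
case: (boolP (P i)) => Pi.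
  have := inHD (HF _ Pi) IHs.
  by congr inH; apply/funext => a; rewrite big_cons Pi.
by move: IHs; congr inH; apply/funext => a; rewrite big_cons (negbTE Pi).
Qed.

Lemma inH_finsupp f s : (forall a, a \notin s -> f a = 0) -> inH f.
Proof.
move=> fs; exists (\sum_(a <- undup s) W f a) => N; rewrite wsqE.
rewrite (bigID (mem s)) /= [X in _ + X]big1 ?addr0; last first.
  by move=> a /fs ->; rewrite abs20 mul0r.
rewrite -big_filter; apply: ler_sum_sub; rewrite ?undup_uniq ?filter_uniq ?box_uniq //.
  exact: W_ge0.
by move=> a; rewrite mem_filter mem_undup => /andP[].
Qed.

Lemma inH_poly f : is_poly f -> inH f.
Proof.
move=> [N fN]; apply: (@inH_finsupp f (box n N)) => a aN; apply: fN.
by rewrite leqNgt; apply: contra aN; exact: box_deg.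
Qed.

Definition mono a : Hsp R n := fun b => (b == a)%:R.

Lemma mono_poly a : is_poly (mono a).
Proof.
exists (deg a).+1 => b; rewrite /mono; case: eqP => // -> /=.
by rewrite ltnn.
Qed.

Lemma inH_mono a : inH (mono a).
Proof. exact/inH_poly/mono_poly. Qed.

End Norm.

(** * Inner product: convergence, sesquilinearity, Cauchy-Schwarz *)

Section InnerProduct.
Variables (R : realType) (n m : nat).
Hypothesis m_gt0 : (0 < m)%N.
Implicit Types (f g u v : Hsp R n) (a b : mi n) (s : seq (mi n)) (c : R[i]).
Local Notation inH := (@inH R n m).
Local Notation normsq := (@normsq R n m).
Local Notation ip := (@ip R n m).
Local Notation bounded_op := (@bounded_op R n m).
Local Notation mono := (@mono R n).

Definition cvgC (u : nat -> R[i]) (l : R[i]) : Prop :=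
  ((fun N => complex.Re (u N)) @ \oo --> complex.Re l)%classic /\
  ((fun N => complex.Im (u N)) @ \oo --> complex.Im l)%classic.

Lemma cvgC_lin c (u v : nat -> R[i]) k l : cvgC u k -> cvgC v l ->
  cvgC (fun N => c * u N + v N) (c * k + l).
Proof.
case: c k l => [c1 c2] [k1 k2] [l1 l2] [/= uR uI] [/= vR vI].
split=> /=.
  have -> : (fun N => complex.Re (Complex c1 c2 * u N + v N)) =
    (fun N => c1 * complex.Re (u N) - c2 * complex.Im (u N) + complex.Re (v N)).
    by apply/funext => N; case: (u N) (v N) => [? ?] [? ?].
  by apply: cvgD => //; apply: cvgB; apply: cvgMl_tmp.
have -> : (fun N => complex.Im (Complex c1 c2 * u N + v N)) =
  (fun N => c1 * complex.Im (u N) + c2 * complex.Re (u N) + complex.Im (v N)).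
  by apply/funext => N; case: (u N) (v N) => [? ?] [? ?].
by apply: cvgD => //; apply: cvgD; apply: cvgMl_tmp.
Qed.

Lemma cvgC_conj (u : nat -> R[i]) k : cvgC u k -> cvgC (fun N => conjc (u N)) (conjc k).
Proof.
case: k => [k1 k2] [/= uR uI]; split=> /=.
  by apply: cvg_trans uR; apply: near_eq_cvg; apply: nearW => N; case: (u N).
have -> : (fun N => complex.Im (conjc (u N))) = (fun N => - complex.Im (u N)).
  by apply/funext => N; case: (u N).
exact: cvgN.
Qed.

Lemma cvgC_unique (u : nat -> R[i]) k l : cvgC u k -> cvgC u l -> k = l.
Proof.
case: k l => [k1 k2] [l1 l2] [/= uR uI] [/= vR vI].
by congr Complex; [apply: cvg_unique uR vR | apply: cvg_unique uI vI].
Qed.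

Lemma ipsumE f g N : ipsum m f g N =
  \sum_(a <- box n N) f a * conjc (g a) / (rho m a)%:R.
Proof. by rewrite -big_box. Qed.

Lemma Re_sum (I : Type) (s : seq I) (F : I -> R[i]) :
  complex.Re (\sum_(i <- s) F i) = \sum_(i <- s) complex.Re (F i).
Proof.
elim: s => [|i s IHs]; first by rewrite !big_nil.
by rewrite !big_cons -IHs; case: (F i) (\sum_(j <- s) F j) => [? ?] [? ?].
Qed.

(** Polarization reduces the convergence of inner products to that of the monotone sums [wsq]. *)
Lemma Re_ipsumE f g N : complex.Re (ipsum m f g N) =
  2^-1 * (wsq m (fun a => f a + g a) N - wsq m f N - wsq m g N).
Proof.
rewrite ipsumE !wsqE Re_sum -!sumrB mulr_sumr; apply: eq_bigr => a _.
have := rhoR_gt0 R m_gt0 a; rewrite -[X in _ / X]/(_) natC -fmorphV.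
case: (f a) (g a) => [f1 f2] [g1 g2] r0; rewrite /abs2 /= /real_complex_def /=.
by field; rewrite gt_eqF.
Qed.

(** The factor $i$ leaves the second slot as $-i$, and $\mathrm{Re}(-iz)=\mathrm{Im}\,z$; imaginary
    parts thus converge because real parts do. *)
Lemma Im_ipsumE f g N : complex.Im (ipsum m f g N) =
  complex.Re (ipsum m f (fun a => 'i%C * g a) N).
Proof.
rewrite !ipsumE.
have -> : \sum_(a <- box n N) f a * conjc ('i%C * g a) / (rho m a)%:R
  = - 'i%C * \sum_(a <- box n N) f a * conjc (g a) / (rho m a)%:R.
  rewrite mulr_sumr; apply: eq_bigr => a _; rewrite !mulrA; congr (_ / _).
  by case: (f a) (g a) => [f1 f2] [g1 g2]; congr Complex => /=; ring.
case: (\sum_(_ <- _) _) => [x y] /=; ring.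
Qed.

Lemma ipsum_cvg f g : inH f -> inH g -> cvgC (ipsum m f g) (ip f g).
Proof.
have HR u v : inH u -> inH v -> cvgn (fun N => complex.Re (ipsum m u v N)).
  move=> Hu Hv.
  have -> : (fun N => complex.Re (ipsum m u v N)) = (fun N =>
     2^-1 * (wsq m (fun a => u a + v a) N - wsq m u N - wsq m v N)).
    by apply/funext => N; exact: Re_ipsumE.
  apply: is_cvgMl_tmp; apply: is_cvgB; last exact: wsq_cvg.
  by apply: is_cvgB; apply: wsq_cvg => //; exact: inHD.
move=> Hf Hg; split=> /=; first exact: HR.
have -> : (fun N => complex.Im (ipsum m f g N))
  = (fun N => complex.Re (ipsum m f (fun a => 'i%C * g a) N)).
  by apply/funext => N; exact: Im_ipsumE.
exact/HR/inHZ.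
Qed.

Lemma ip_eq f g u v : inH f -> inH g -> inH u -> inH v ->
  (forall a, f a * conjc (g a) = u a * conjc (v a)) -> ip f g = ip u v.
Proof.
move=> Hf Hg Hu Hv E; apply: cvgC_unique (ipsum_cvg Hf Hg) _.
have -> : ipsum m f g = ipsum m u v; last exact: ipsum_cvg.
by apply/funext => N; rewrite !ipsumE; apply: eq_bigr => a _; rewrite E.
Qed.

Lemma ip_lin c f g u : inH f -> inH g -> inH u ->
  ip (fun a => c * f a + g a) u = c * ip f u + ip g u.
Proof.
move=> Hf Hg Hu; apply: cvgC_unique (ipsum_cvg (inH_lin m_gt0 c Hf Hg) Hu) _.
have -> : ipsum m (fun a => c * f a + g a) u = fun N => c * ipsum m f u N + ipsum m g u N.
  apply/funext => N; rewrite !ipsumE mulr_sumr -big_split /=.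
  by apply: eq_bigr => a _; ring.
by apply: cvgC_lin; exact: ipsum_cvg.
Qed.

Lemma ip_conj f g : inH f -> inH g -> ip g f = conjc (ip f g).
Proof.
move=> Hf Hg; apply: cvgC_unique (ipsum_cvg Hg Hf) _.
have -> : ipsum m g f = fun N => conjc (ipsum m f g N).
  apply/funext => N; rewrite !ipsumE rmorph_sum; apply: eq_bigr => a _.
  by rewrite !rmorphM /= conjcK conjc_inv conjc_nat [conjc _ * g a]mulrC.
by apply: cvgC_conj; exact: ipsum_cvg.
Qed.

Lemma ip_normsq f : inH f -> ip f f = ((normsq f)%:C)%C.
Proof.
move=> Hf; apply: cvgC_unique (ipsum_cvg Hf Hf) _.
have -> : ipsum m f f = fun N => ((wsq m f N)%:C)%C.
  apply/funext => N; rewrite !ipsumE wsqE rmorph_sum; apply: eq_bigr => a _.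
  rewrite rmorphM fmorphV rmorph_nat; congr (_ / _).
  by case: (f a) => [x y]; congr Complex; rewrite /abs2 /=; ring.
split=> /=; first exact: wsq_cvg.
exact: cvg_cst.
Qed.

Lemma ip0l g : inH g -> ip (fun=> 0) g = 0.
Proof.
move=> Hg; have H0 := inH0 R n m.
rewrite (ip_eq (u := fun=> 0) (v := fun=> 0)) ?ip_normsq //; last by move=> a; rewrite !mul0r.
suff -> : normsq (fun=> 0) = 0 by [].
apply/eqP; rewrite eq_le normsq_ge0 // andbT.
by apply: (normsq_le _).2 => // N; rewrite wsqE big1 // => a _; rewrite abs20 mul0r.
Qed.

Lemma ipD f g u : inH f -> inH g -> inH u ->
  ip (fun a => f a + g a) u = ip f u + ip g u.
Proof.
move=> Hf Hg Hu; rewrite -[ip f u]mul1r -ip_lin //; congr ip.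
by apply/funext => a; rewrite mul1r.
Qed.

Lemma ipB f g u : inH f -> inH g -> inH u ->
  ip (fun a => f a - g a) u = ip f u - ip g u.
Proof.
move=> Hf Hg Hu; rewrite addrC -mulN1r -ip_lin //; congr ip.
by apply/funext => a; rewrite mulN1r addrC.
Qed.

Lemma ip_sum (I : Type) (s : seq I) (F : I -> Hsp R n) g :
  (forall i, inH (F i)) -> inH g ->
  ip (fun a => \sum_(i <- s) F i a) g = \sum_(i <- s) ip (F i) g.
Proof.
move=> HF Hg; elim: s => [|i s IHs].
  rewrite big_nil -[RHS](ip0l Hg); congr ip; apply/funext => a.
  by rewrite big_nil.
rewrite big_cons -IHs -ipD //; last exact: inH_sum.
by congr ip; apply/funext => a; rewrite big_cons.
Qed.

Lemma ip_mono a g : inH g -> ip (mono a) g = conjc (g a) / (rho m a)%:R.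
Proof.
move=> Hg; apply: cvgC_unique (ipsum_cvg (inH_mono _ _ _) Hg) _.
suff H : (\forall N \near \oo, ipsum m (mono a) g N = conjc (g a) / (rho m a)%:R)%classic.
  by split; apply: cvg_near_cst; apply: filterS H => N /= ->.
exists (deg a).+1 => // N /= aN; rewrite ipsumE.
rewrite (bigD1_seq a) ?box_uniq ?box_deg //= {1}/mono eqxx mul1r big1 ?addr0 //.
by move=> b /negbTE ba; rewrite /mono ba !mul0r.
Qed.

(** Pairing with a monomial recovers a coefficient up to a nonzero weight; values of adjoints are
    identified this way. *)
Lemma ip_mono_inj f g : inH f -> inH g -> (forall a, ip (mono a) f = ip (mono a) g) -> f = g.
Proof.
move=> Hf Hg E; apply/funext => a; have := E a; rewrite !ip_mono //.
have r0 : (rho m a)%:R^-1 != 0 :> R[i] by rewrite invr_eq0 pnatr_eq0 -lt0n rho_gt0.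
by move/(mulIf r0)/(can_inj (@conjcK _)).
Qed.

Lemma cauchy_schwarz f g : inH f -> inH g -> abs2 (ip f g) <= normsq f * normsq g.
Proof.
move=> Hf Hg; set z := ip f g; set k := normsq g.
have k0 : 0 <= k by exact: normsq_ge0.
have [k00|kn0] := eqVneq k 0.
  have -> : z = 0.
    rewrite /z (normsq_eq0 m_gt0 Hg k00) ip_conj ?ip0l //; last exact: inH0.
    by rewrite conjc0.
  by rewrite abs20 k00 mulr0.
have kp : 0 < k by rewrite lt_def kn0.
(* With $k=\|g\|^2$ and $z=\langle f,g\rangle$, the vector $u=kf-zg$ is orthogonal to $g$ and
   $\|u\|^2=k(k\|f\|^2-|z|^2)$; nonnegativity and $k>0$ give the claim. *)
pose u := fun a => (- z) * g a + (fun a => k%:C%C * f a) a.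
have Hkf : inH (fun a => k%:C%C * f a) by exact: inHZ.
have Hu : inH u by exact: inH_lin.
have fu : ip f u = 0 + conjc (- z) * z + k%:C%C * ip f f.
  rewrite ip_conj // /u ip_lin // [ip g f]ip_conj // -/z.
  have -> : ip (fun a => k%:C%C * f a) f = k%:C%C * ip f f.
    rewrite -[RHS]addr0 -(ip0l Hf) -ip_lin //; last exact: inH0.
    by congr ip; apply/funext => a; rewrite addr0.
  have E (w : R[i]) (r t : R) : conjc (- w * conjc w + r%:C%C * t%:C%C)
      = conjc (- w) * w + r%:C%C * t%:C%C.
    by case: w => x y; congr Complex => /=; ring.
  by rewrite ip_normsq // add0r E.
have gu : ip g u = 0.
  rewrite ip_conj // /u ip_lin //.
  have -> : ip (fun a => k%:C%C * f a) g = k%:C%C * z.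
    rewrite -[RHS]addr0 -(ip0l Hg) -ip_lin //; last exact: inH0.
    by congr ip; apply/funext => a; rewrite addr0.
  by rewrite ip_normsq // -/k mulNr mulrC addNr conjc0.
have := normsq_ge0 Hu; rewrite -lecR -ip_normsq //.
rewrite {1}/u ip_lin // gu mulr0 add0r.
have -> : ip (fun a => k%:C%C * f a) u = k%:C%C * ip f u.
  rewrite -[RHS]addr0 -(ip0l Hu) -ip_lin //; last exact: inH0.
  by congr ip; apply/funext => a; rewrite addr0.
rewrite fu ip_normsq // add0r.
have -> : k%:C%C * (conjc (- z) * z + k%:C%C * (normsq f)%:C%C)
   = (k * (normsq f * k - abs2 z))%:C%C.
  by case: z {u Hu fu gu} => x y; congr Complex; rewrite /abs2 /=; ring.
by rewrite lecR pmulr_rge0 // subr_ge0.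
Qed.

End InnerProduct.

(** * Bounded operators, adjoints, and explicit forms of $M_{z_i}^*$, $\delta$ and $M_z'^*$ *)

Section Operators.
Variables (R : realType) (n m : nat).
Hypothesis m_gt0 : (0 < m)%N.
Implicit Types (f g u v : Hsp R n) (a b : mi n) (s : seq (mi n)) (c : R[i])
  (i : 'I_n) (A B : Hsp R n -> Hsp R n).
Local Notation inH := (@inH R n m).
Local Notation normsq := (@normsq R n m).
Local Notation ip := (@ip R n m).
Local Notation bounded_op := (@bounded_op R n m).
Local Notation mono := (@mono R n).

(** Density of the polynomials: [phi] vanishes on the box truncations of [f], which converge to [f]
    in norm. Only monomials occurring in [f] are tested, so the criterion also serves for vectors
    without constant term. *)
Lemma bounded_functional_eq0 (phi : Hsp R n -> R[i]) (k : R) :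
  (forall c f g, inH f -> inH g ->
     phi (fun a => c * f a + g a) = c * phi f + phi g) ->
  (forall f, inH f -> abs2 (phi f) <= k * normsq f) ->
  forall f, inH f -> (forall a, f a != 0 -> phi (mono a) = 0) -> phi f = 0.
Proof.
move=> lin bd f Hf f0.
have phi0 : phi (fun=> 0) = 0.
  apply: abs2_eq0; apply/eqP; rewrite eq_le abs2_ge0 andbT.
  apply: le_trans (bd _ (inH0 _ _ _)) _.
  suff -> : normsq (fun=> 0) = 0 by rewrite mulr0.
  by have := ip_normsq m_gt0 (inH0 R n m); rewrite ip0l //; [case|exact: inH0].
pose tr s : Hsp R n := fun b => \sum_(a <- s) f a * mono a b.
have Htr s : inH (tr s).
  by apply: inH_sum => // a _; apply: inHZ => //; exact: inH_mono.
have phitr s : phi (tr s) = 0.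
  elim: s => [|a s IHs].
    by rewrite -[RHS]phi0; congr phi; apply/funext => b; rewrite /tr big_nil.
  have -> : tr (a :: s) = fun b => f a * mono a b + tr s b.
    by apply/funext => b; rewrite /tr big_cons.
  rewrite lin //; last exact: inH_mono.
  rewrite IHs addr0; case: (eqVneq (f a) 0) => [->|/f0->]; first by rewrite mul0r.
  by rewrite mulr0.
have trE N b : tr (box n N) b = if b \in box n N then f b else 0.
  case: ifP => bN.
    rewrite /tr (bigD1_seq b) ?box_uniq //= {1}/mono eqxx mulr1 big1 ?addr0 //.
    by move=> a /negbTE; rewrite eq_sym /mono => ->; rewrite mulr0.
  rewrite /tr big_seq big1 // => a aN; rewrite /mono.
  by case: eqP => [E|_]; [rewrite E aN in bN | rewrite mulr0].
(* The remainder lives outside the box of size [N]; its terms and those of [wsq m f N] together run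
   over a duplicate-free list, whose sum is at most [normsq f]. *)
have tail N : normsq (fun b => f b - tr (box n N) b) <= normsq f - wsq m f N.
  apply: (normsq_le _).2 => M; rewrite lerBrDl !wsqE.
  have -> : \sum_(a <- box n M) abs2 (f a - tr (box n N) a) / (rho m a)%:R
     = \sum_(a <- [seq a <- box n M | a \notin box n N]) abs2 (f a) / (rho m a)%:R.
    rewrite [RHS]big_filter [RHS]big_mkcond /=; apply: eq_bigr => a _.
    by rewrite trE; case: ifP => aN /=; rewrite ?subr0 // subrr abs20 mul0r.
  rewrite -big_cat; apply: inH_seq_le => //; rewrite cat_uniq !box_uniq ?filter_uniq ?box_uniq //=.
  by rewrite andbT; apply/hasPn => a; rewrite mem_filter => /andP[].
apply: abs2_eq0; apply/eqP; rewrite eq_le abs2_ge0 andbT.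
have kn N : abs2 (phi f) <= `|k| * (normsq f - wsq m f N).
  have Hd : inH (fun b => f b - tr (box n N) b) by exact: inHB.
  have -> : phi f = phi (fun b => f b - tr (box n N) b).
    rewrite -[RHS]mul1r -[RHS]addr0 -(phitr (box n N)) -lin //; congr phi.
    by apply/funext => b; rewrite mul1r subrK.
  apply: le_trans (bd _ Hd) _.
  apply: (@le_trans _ _ (`|k| * normsq (fun b => f b - tr (box n N) b))).
    by rewrite ler_wpM2r ?normsq_ge0 ?ler_norm.
  by rewrite ler_wpM2l.
have cv : ((fun N => `|k| * (normsq f - wsq m f N)) @ \oo --> `|k| * (normsq f - normsq f))%classic.
  by apply: cvgMl_tmp; apply: cvgB; [exact: cvg_cst|exact: wsq_cvg].
rewrite subrr mulr0 in cv; rewrite -(cvg_lim _ cv) //.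
apply: limr_ge; first by apply/cvg_ex; exists 0.
by apply: nearW.
Qed.

Lemma bounded_opH A f : bounded_op A -> inH f -> inH (A f).
Proof. by move=> [AH _]; exact: AH. Qed.

Lemma bounded_op_lin A c f g : bounded_op A -> inH f -> inH g ->
  A (fun a => c * f a + g a) = fun a => c * A f a + A g a.
Proof. by move=> [_ [AL _]]; exact: AL. Qed.

Lemma bounded_op_bound A : bounded_op A ->
  exists2 k : R, 0 <= k & forall f, inH f -> normsq (A f) <= k * normsq f.
Proof.
move=> [_ [_ [k Ak]]]; exists `|k| => // f Hf; apply: le_trans (Ak f Hf) _.
by rewrite ler_wpM2r ?normsq_ge0 ?ler_norm.
Qed.

Lemma bounded_op_eq A B : (forall f, inH f -> A f = B f) -> bounded_op A -> bounded_op B.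
Proof.
move=> AB [AH [AL [k Ak]]]; split; first by move=> f Hf; rewrite -AB //; exact: AH.
split=> [c f g Hf Hg|]; first by rewrite -!AB // ?AL //; exact: inH_lin.
by exists k => f Hf; rewrite -AB //; exact: Ak.
Qed.

Lemma bounded_op_comp A B : bounded_op A -> bounded_op B -> bounded_op (fun f => A (B f)).
Proof.
move=> HA HB; split; first by move=> f Hf; exact/bounded_opH/bounded_opH.
split=> [c f g Hf Hg|].
  by rewrite bounded_op_lin // bounded_op_lin //; exact: bounded_opH.
have [k k0 Ak] := bounded_op_bound HA; have [l l0 Bl] := bounded_op_bound HB.
exists (k * l) => f Hf; apply: le_trans (Ak _ (bounded_opH HB Hf)) _.
by rewrite -mulrA ler_wpM2l // Bl.
Qed.

Lemma bounded_op_lincomb c A B : bounded_op A -> bounded_op B ->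
  bounded_op (fun f a => c * A f a + B f a).
Proof.
move=> HA HB; split.
  by move=> f Hf; apply: inH_lin => //; exact: bounded_opH.
split=> [d f g Hf Hg|].
  by rewrite !bounded_op_lin //; apply/funext => a; ring.
have [k k0 Ak] := bounded_op_bound HA; have [l l0 Bl] := bounded_op_bound HB.
exists (2 * abs2 c * k + 2 * l) => f Hf.
have [_ H] := lin_bound m_gt0 c (bounded_opH HA Hf) (bounded_opH HB Hf).
apply: le_trans H _; rewrite [leRHS]mulrDl -!mulrA lerD //.
  by rewrite !ler_wpM2l ?abs2_ge0 // Ak.
by rewrite ler_wpM2l // Bl.
Qed.

Lemma bounded_op0 : bounded_op (fun _ _ => 0).
Proof.
split; first by move=> f _; exact: inH0.
split=> [c f g _ _|]; first by apply/funext => a; rewrite mulr0 addr0.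
exists 0 => f Hf; rewrite mul0r; apply: (normsq_le _).2 => N.
by rewrite wsqE big1 // => a _; rewrite abs20 mul0r.
Qed.

Lemma bounded_op_sum (I : Type) (s : seq I) (c : I -> R[i]) (F : I -> Hsp R n -> Hsp R n) :
  (forall j, bounded_op (F j)) ->
  bounded_op (fun f a => \sum_(j <- s) c j * F j f a).
Proof.
move=> HF; elim: s => [|j s IHs].
  apply: bounded_op_eq bounded_op0 => f _; apply/funext => a.
  by rewrite big_nil.
apply: bounded_op_eq (bounded_op_lincomb (c j) (HF j) IHs) => f _.
by apply/funext => a; rewrite big_cons.
Qed.

Lemma bounded_op_reindex A (k : R) (P : pred (mi n)) (phi : mi n -> mi n) :
  (forall c f g, A (fun a => c * f a + g a) = fun a => c * A f a + A g a) ->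
  0 <= k ->
  (forall f a, ~~ P a -> A f a = 0) -> {in P &, injective phi} ->
  (forall f a, P a -> abs2 (A f a) / (rho m a)%:R <=
      k * (abs2 (f (phi a)) / (rho m (phi a))%:R)) ->
  bounded_op A.
Proof.
move=> AL k0 A0 phiI Ab.
have H f : inH f -> inH (A f) /\ normsq (A f) <= k * normsq f.
  by move=> Hf; apply: (reindex_bound Hf k0 (A0 f) phiI (Ab f)).
by split=> [f /H[]|]//; split=> [*|]//; exists k => f /H[].
Qed.

(** Coefficients are bounded functionals by [coef_le], so density of the polynomials applies to
    $f\mapsto (Af)_b$. *)
Lemma coef_functional_eq0 A f b : bounded_op A -> inH f ->
  (forall a, f a != 0 -> A (mono a) b = 0) -> A f b = 0.
Proof.
move=> HA Hf; have [k k0 Ak] := bounded_op_bound HA.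
apply: (bounded_functional_eq0 (phi := fun f => A f b) (k := (rho m b)%:R * k)) => //.
  by move=> c u v Hu Hv; rewrite bounded_op_lin.
move=> u Hu; apply: le_trans (coef_le m_gt0 _ (bounded_opH HA Hu)) _.
by rewrite -mulrA ler_wpM2l // Ak.
Qed.

(** By Cauchy-Schwarz both sides of the adjoint relation are bounded in the first argument, so their
    difference vanishes once it vanishes on monomials. *)
Lemma is_adj_mono A B : bounded_op A -> (forall g, inH g -> inH (B g)) ->
  (forall a g, inH g -> ip (A (mono a)) g = ip (mono a) (B g)) -> is_adj_HH m A B.
Proof.
move=> HA HB AB; split=> // f g Hf Hg; apply/eqP; rewrite -subr_eq0; apply/eqP.
have [k k0 Ak] := bounded_op_bound HA.
have HAf u : inH u -> inH (A u) by exact: bounded_opH.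
have HBg := HB _ Hg.
apply: (bounded_functional_eq0 (phi := fun f => ip (A f) g - ip f (B g))
  (k := 2 * (k * normsq g) + 2 * normsq (B g))) => //.
- move=> c u v Hu Hv; rewrite bounded_op_lin // !ip_lin //; [ring|exact: HAf|exact: HAf].
- move=> u Hu; apply: le_trans (abs2D _ _) _.
  rewrite abs2N [leRHS]mulrDl -!mulrA lerD // ler_wpM2l //.
    apply: le_trans (cauchy_schwarz m_gt0 (HAf _ Hu) Hg) _.
    by rewrite [normsq g * _]mulrC mulrA ler_wpM2r ?normsq_ge0 // Ak.
  by rewrite mulrC cauchy_schwarz.
- by move=> a _; rewrite AB // subrr.
Qed.

(** The classical choice yields an adjoint as soon as one exists; pairing with monomials shows that
    its values on the space are those of [B]. *)
Lemma adj_HHE A B f : is_adj_HH m A B -> inH f -> adj_HH m A f = B f.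
Proof.
move=> AB Hf.
have : is_adj_HH m A (adj_HH m A) by apply: epsilon_spec; exists B.
move=> [H1 H2]; have [H3 H4] := AB.
apply: (ip_mono_inj m_gt0); [exact: H1|exact: H3|move=> a].
by rewrite -H2 -?H4 //; exact: inH_mono.
Qed.

Lemma rho_addeV (F : numFieldType) a i : (rho m (adde a i))%:R^-1 =
  ((a i).+1%:R / (m + deg a)%:R) * (rho m a)%:R^-1 :> F.
Proof.
have r0 b : (rho m b)%:R != 0 :> F by rewrite pnatr_eq0 -lt0n rho_gt0.
have d0 : (m + deg a)%:R != 0 :> F by rewrite pnatr_eq0 -lt0n addn_gt0 m_gt0.
have := congr1 (fun k => k%:R : F) (rho_adde a i m_gt0); rewrite !natrM => E.
apply: (mulfI (r0 (adde a i))); rewrite mulfV // !mulrA E.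
by rewrite mulfK // mulfV.
Qed.

Lemma rho_adde_ratio_le1 a i : (a i).+1%:R / (m + deg a)%:R <= 1 :> R.
Proof.
rewrite ler_pdivrMr ?mul1r ?ler_nat ?ltr0n ?addn_gt0 ?m_gt0 //.
by rewrite -add1n leq_add // le_deg.
Qed.

(* The coefficient formula for [M_{z_i}^*]: the ratio is rho_m(alpha)/rho_m(alpha + e_i). *)
Definition bshift i f : Hsp R n :=
  fun a => ((a i).+1%:R / (m + deg a)%:R) * f (adde a i).

Lemma Mzi_lin i c f g :
  Mzi i (fun a => c * f a + g a) = fun a => c * Mzi i f a + Mzi i g a.
Proof. by apply/funext => a; rewrite /Mzi; case: ifP => // _; rewrite mulr0 addr0. Qed.

Lemma bounded_op_Mzi i : bounded_op (Mzi i).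
Proof.
apply: (bounded_op_reindex (k := 1) (P := fun a : mi n => (0 < a i)%N)
   (phi := fun a => sube a i)) => //.
- exact: Mzi_lin. 
- by move=> f a /negbTE; rewrite /Mzi => ->.
- by move=> a b a0 b0 E; rewrite -(subeK a0) -(subeK b0) E.
- move=> f a a0; rewrite /Mzi a0 mul1r ler_wpM2l ?abs2_ge0 //.
  rewrite -{1}(subeK a0) rho_addeV ler_piMl ?invr_ge0 //.
  exact: rho_adde_ratio_le1.
Qed.

Lemma bounded_op_bshift i : bounded_op (bshift i).
Proof.
apply: (bounded_op_reindex (k := 1) (P := predT) (phi := fun a => adde a i)) => //.
- by move=> c f g; apply/funext => a; rewrite /bshift; ring.
- by move=> a b _ _ /(can_inj (addeK i)).
- move=> f a _; rewrite mul1r /bshift divnatC abs2M abs2_real rho_addeV.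
  set q := _ / _; have q0 : 0 <= q by rewrite divr_ge0.
  rewrite mulrA [abs2 _ * q]mulrC ler_wpM2r ?invr_ge0 // ler_wpM2r ?abs2_ge0 //.
  by rewrite expr2 ler_piMl // rho_adde_ratio_le1.
Qed.

Lemma Mzi_mono a i : Mzi i (mono a) = mono (adde a i).
Proof.
apply/funext => b; rewrite /Mzi /mono; case: ifP => b0.
  congr (_ %:R); congr nat_of_bool; apply/eqP/eqP => [<-|->]; first by rewrite subeK.
  exact: addeK.
by case: eqP => // E; rewrite E adde_ii in b0.
Qed.

(** On monomials the relation is the weight ratio
    $\rho_m(\alpha)/\rho_m(\alpha+e_i)=(\alpha_i+1)/(m+|\alpha|)$. *)
Lemma is_adj_Mzi i : is_adj_HH m (Mzi i) (bshift i).
Proof.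
apply: is_adj_mono; first exact: bounded_op_Mzi.
  by move=> g; exact/bounded_opH/bounded_op_bshift.
move=> a g Hg; rewrite Mzi_mono !ip_mono //; last exact/bounded_opH/Hg/bounded_op_bshift.
by rewrite rho_addeV /bshift !rmorphM /= conjc_inv !conjc_nat; ring.
Qed.

Lemma Mzi_adjE i f : inH f -> Mzi_adj m i f = bshift i f.
Proof. by move=> Hf; apply: adj_HHE => //; exact: is_adj_Mzi. Qed.

Lemma ip_Mzi i f g : inH f -> inH g -> ip (Mzi i f) g = ip f (bshift i g).
Proof. exact: (is_adj_Mzi i).2. Qed.

Definition dlt (k : nat) : R := if k == 0%N then 1 else (m + k - 1)%:R / k%:R.

Lemma deltaE f : delta m f = fun a => ((dlt (deg a))%:C)%C * f a.
Proof.
apply/funext => a; rewrite /delta /dlt; case: ifP => _; first by rewrite mul1r.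
by rewrite divnatC.
Qed.

Lemma dlt_le k : 0 <= dlt k <= m%:R.
Proof.
rewrite /dlt; case: k => [|k] /=; first by rewrite ler01 ler1n.
rewrite divr_ge0 //= ler_pdivrMr ?ltr0n // -natrM ler_nat.
by rewrite addnS subn1 /= mulnS leq_add2l leq_pmull.
Qed.

Lemma bounded_op_delta : bounded_op (delta m).
Proof.
apply: (bounded_op_reindex (k := m%:R ^+ 2) (P := predT) (phi := id)) => //.
- by move=> c f g; rewrite !deltaE; apply/funext => a; ring.
- by rewrite exprn_ge0.
- move=> f a _; rewrite deltaE abs2M abs2_real mulrA ler_wpM2r ?invr_ge0 //.
  have /andP[d0 d1] := dlt_le (deg a).
  by rewrite ler_wpM2r ?abs2_ge0 // lerXn2r ?nnegrE.
Qed.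

Lemma ip_delta f g : inH f -> inH g -> ip (delta m f) g = ip f (delta m g).
Proof.
move=> Hf Hg; have Hd := fun f => bounded_opH (f := f) bounded_op_delta.
apply: ip_eq => //; [exact: Hd|exact: Hd|move=> a].
have -> : conjc (delta m g a) = ((dlt (deg a))%:C)%C * conjc (g a).
  by rewrite deltaE; case: (g a) => x y; congr Complex => /=; ring.
by rewrite deltaE; ring.
Qed.

Lemma inH_Mz (F : Hnsp R n) : inHn m F -> inH (Mz F).
Proof.
by move=> HF; apply: inH_sum => // i _; exact/bounded_opH/HF/bounded_op_Mzi.
Qed.

Lemma inH_Mzp (F : Hnsp R n) : inHn m F -> inH (Mzp m F).
Proof. by move=> HF; apply: bounded_opH (inH_Mz HF); exact: bounded_op_delta. Qed.

Lemma ip_Mz (F : Hnsp R n) g : inHn m F -> inH g -> ip (Mz F) g = ipn m F (fun i => bshift i g).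
Proof.
move=> HF Hg; rewrite /Mz ip_sum //.
  by apply: eq_bigr => i _; rewrite ip_Mzi.
by move=> i; exact/bounded_opH/HF/bounded_op_Mzi.
Qed.

(** The eigenvalues of $\delta$ are real, so $\delta$ is self-adjoint and the adjoint of $\delta
    M_z$ is $M_z^*\delta$. *)
Lemma Mzp_adjE f : inH f -> Mzp_adj m f = fun i => bshift i (delta m f).
Proof.
move=> Hf.
have Hd := fun f => bounded_opH (f := f) bounded_op_delta.
have Hb i := fun f => bounded_opH (f := f) (bounded_op_bshift i).
have adjB : is_adj_HnH m (Mzp m) (fun f i => bshift i (delta m f)).
  split; first by move=> u Hu i; exact/Hb/Hd.
  move=> F g HF Hg; rewrite /Mzp ip_delta //; last exact: inH_Mz.
  by rewrite ip_Mz //; exact: Hd.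
have [H1 H2] : is_adj_HnH m (@Mzp R n m) (Mzp_adj m).
  by apply: epsilon_spec; eexists; exact: adjB.
have [H3 H4] := adjB.
apply/funext => i; apply: (ip_mono_inj m_gt0); [exact: (H1 f Hf i)|exact: (H3 f Hf i)|move=> a].
(* A monomial placed in slot [i] alone isolates component [i] of the pairing of tuples. *)
pose F : Hnsp R n := fun j => if j == i then mono a else fun=> 0.
have HF : inHn m F by move=> j; rewrite /F; case: ifP => _; [exact: inH_mono|exact: inH0].
have FE (G : Hnsp R n) : inHn m G -> ipn m F G = ip (mono a) (G i).
  move=> HG; rewrite /ipn (bigD1 i) //= {1}/F eqxx big1 ?addr0 //.
  by move=> j /negbTE ji; rewrite /F ji ip0l.
have B2 : inHn m (fun j => bshift j (delta m f)) by exact: H3.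
by rewrite -(FE _ (H1 _ Hf)) -(FE _ B2) -H2 // -H4.
Qed.

End Operators.

(** * The range of $M_z^*$: closedness, and the projection $M_z^*\delta M_z$ onto it *)

Section Projection.
Variables (R : realType) (n m : nat).
Hypothesis m_gt0 : (0 < m)%N.
Implicit Types (f g u v : Hsp R n) (a b : mi n) (c : R[i])
  (i j : 'I_n) (F G : Hnsp R n).
Local Notation inH := (@inH R n m).
Local Notation inHn := (@inHn R n m).
Local Notation normsq := (@normsq R n m).
Local Notation ip := (@ip R n m).
Local Notation bounded_op := (@bounded_op R n m).
Local Notation range := (@rangeMz_adj R n m).

Lemma inH_bshift i f : inH f -> inH (bshift m i f).
Proof. exact/bounded_opH/bounded_op_bshift. Qed.

(** Index [i] contributes $\alpha_i/(m+|\alpha|-1)$, and the $\alpha_i$ add up to $|\alpha|$. In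
    degree 0 with $m=1$ the quotient is $0/0$, which evaluates to the correct value 0. *)
Lemma Mz_bshift f a :
  Mz (fun i => bshift m i f) a = (deg a)%:R / (m + deg a - 1)%:R * f a.
Proof.
have E i : Mzi i (bshift m i f) a = (a i)%:R / (m + deg a - 1)%:R * f a.
  rewrite /Mzi /bshift; case: ifPn => [a0|]; last first.
    by rewrite -eqn0Ngt => /eqP ->; rewrite !mul0r.
  rewrite subeK // sube_ii prednK // deg_sube //.
  suff -> : (m + (deg a).-1 = m + deg a - 1)%N by [].
  by rewrite subn1 -[in RHS](prednK (leq_trans a0 (le_deg a i))) addnS.
by rewrite /Mz (eq_bigr _ (fun i _ => E i)) -!mulr_suml -natr_sum.
Qed.

Lemma Mz_deg0 F a : deg a = 0%N -> Mz F a = 0.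
Proof.
move=> a0; rewrite /Mz big1 // => i _; rewrite /Mzi.
by have := le_deg a i; rewrite a0 leqn0 => /eqP ->.
Qed.

(** In positive degree the eigenvalues of $\delta$ and $M_zM_z^*$ are inverse to each other, and
    $M_zF$ has no constant term. So $M_z$ kills $F-M_z^*\delta M_zF$. *)
Lemma Mz_bshift_delta F : Mz (fun i => bshift m i (Mzp m F)) = Mz F.
Proof.
apply/funext => a; rewrite Mz_bshift /Mzp /delta.
have [a0|a0] := eqVneq (deg a) 0%N; first by rewrite a0 Mz_deg0 // mulr0.
have a0' : (deg a)%:R != 0 :> R[i] by rewrite pnatr_eq0.
have d0 : (m + deg a - 1)%:R != 0 :> R[i].
  by rewrite pnatr_eq0 subn_eq0 -ltnNge -[1%N]/(1 + 0)%N -addnS leq_add // lt0n.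
by field; rewrite a0' d0.
Qed.

Lemma Mz_lin c F G :
  Mz (fun i a => c * F i a + G i a) = fun a => c * Mz F a + Mz G a.
Proof.
apply/funext => a; rewrite /Mz mulr_sumr -big_split /=.
by apply: eq_bigr => i _; rewrite Mzi_lin.
Qed.

Lemma Mz_adjE f : inH f -> Mz_adj m f = fun i => bshift m i f.
Proof. by move=> Hf; apply/funext => i; rewrite /Mz_adj Mzi_adjE. Qed.

Lemma rangeE F : range F <-> exists2 f, inH f & F = fun i => bshift m i f.
Proof.
split; first by move=> [f [Hf ->]]; exists f => //; rewrite Mz_adjE.
by move=> [f Hf ->]; exists f; rewrite Mz_adjE.
Qed.

(** Continuity on tuples of one coefficient of a sum of bounded operators; it lets the fixed-point
    equation of the projection pass to limits. *)
Lemma bounded_coef_sum (A : 'I_n -> Hsp R n -> Hsp R n) a :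
  (forall j, bounded_op (A j)) ->
  exists2 k : R, 0 <= k & forall F, inHn F ->
    abs2 (\sum_j A j (F j) a) <= k * normsqn m F.
Proof.
move=> HA; rewrite /normsqn; elim: (index_enum _) => [|j s [k k0 IHs]].
  by exists 0 => // F _; rewrite !big_nil abs20 mulr0.
have [l l0 Al] := bounded_op_bound (HA j).
have rl0 : 0 <= (rho m a)%:R * l by rewrite mulr_ge0.
exists (2 * ((rho m a)%:R * l) + 2 * k) => [|F HF].
  by rewrite addr_ge0 // mulr_ge0.
rewrite !big_cons; apply: le_trans (abs2D _ _) _.
have H1 : abs2 (A j (F j) a) <= (rho m a)%:R * l * normsq (F j).
  apply: le_trans (coef_le m_gt0 _ (bounded_opH (HA j) (HF j))) _.
  by rewrite -mulrA ler_wpM2l // Al.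
have H2 := IHs F HF; have N0 := normsq_ge0 (HF j).
set S := \sum_(i <- s) normsq (F i) in H2 *.
have S0 : 0 <= S by rewrite sumr_ge0 // => i _; exact: normsq_ge0.
move: H1 H2 rl0; set x := (rho m a)%:R * l; move: (normsq _) N0 => N N0 H1 H2 x0.
have := mulr_ge0 x0 S0; have := mulr_ge0 k0 N0; lra.
Qed.

(** $M_z^*$ reads only coefficients of positive degree, where $\delta M_zM_z^*$ acts as the
    identity. *)
Lemma proj_range F : range F -> (fun i => bshift m i (Mzp m F)) = F.
Proof.
move/rangeE => [f Hf ->]; apply/funext => i; apply/funext => a.
rewrite /bshift /Mzp /delta -/(bshift m) Mz_bshift deg_adde /= addnS subn1 /=.
have d0 : (m + deg a)%:R != 0 :> R[i] by rewrite pnatr_eq0 addn_eq0 negb_and -lt0n m_gt0.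
have e0 : (deg a).+1%:R != 0 :> R[i] by rewrite pnatr_eq0.
move: ((m + deg a)%:R) ((deg a).+1%:R) d0 e0 => x y x0 y0.
by field; rewrite x0 y0.
Qed.

(** The range is closed because it is the fixed-point set of $F\mapsto M_z^*\delta M_zF$, whose
    coefficients are continuous. *)
Lemma closure_rangeE : closure_Hn m range = range.
Proof.
apply/seteqP; split=> F.
  move=> [HF clF]; suff E : F = fun i => bshift m i (Mzp m F).
    by apply/rangeE; exists (Mzp m F) => //; exact: inH_Mzp.
  apply/esym/funext => i; apply/funext => a; apply/eqP; rewrite -subr_eq0; apply/eqP.
  (* Summed over [j], [A j (F j) a] is the coefficient at [a] of component [i] of $M_z^*\delta
     M_zF-F$. *)
  pose A j f := fun b => - (j == i)%:R * f b + bshift m i (delta m (Mzi j f)) b.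
  have HA j : bounded_op (A j).
    apply: bounded_op_lincomb => //.
      by split=> //; split=> //; exists 1 => f _; rewrite mul1r.
    apply: bounded_op_comp; first exact: bounded_op_bshift.
    by apply: bounded_op_comp; [exact: bounded_op_delta|exact: bounded_op_Mzi].
  have AE G : \sum_j A j (G j) a = bshift m i (Mzp m G) a - G i a.
    rewrite /A big_split /= (bigD1 i) //= eqxx big1 ?addr0; last first.
      by move=> j /negbTE ->; rewrite oppr0 mul0r.
    rewrite mulN1r addrC; congr (_ - _).
    rewrite /Mzp /bshift /Mz !deltaE !mulr_sumr.
    by apply: eq_bigr => j _; rewrite deltaE.
  have [k k0 Ak] := bounded_coef_sum a HA.
  rewrite -AE; apply: abs2_eq0; apply/eqP; rewrite eq_le abs2_ge0 andbT.
  apply/ler_addgt0Pr => e e0; rewrite add0r.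
  have k1 : 0 < k + 1 by rewrite ltr_wpDl.
  (* The radius [e / (k + 1)] makes sense for [k = 0] too, and [k] times it is at most [e]. *)
  have [|G [rG FG]] := clF (e / (k + 1)); first by rewrite divr_gt0.
  have HG : inHn G by move/rangeE: (rG) => [f Hf ->] j; exact: inH_bshift.
  have -> : \sum_j A j (F j) a = \sum_j A j (fun b => F j b - G j b) a.
    have AG : \sum_j A j (G j) a = 0 by rewrite AE -{2}(proj_range rG) subrr.
    transitivity (\sum_j A j (F j) a - \sum_j A j (G j) a); first by rewrite AG subr0.
    rewrite -sumrB; apply: eq_bigr => j _.
    have -> : (fun b => F j b - G j b) = fun b => (-1) * G j b + F j b.
      by apply/funext => b; rewrite mulN1r addrC.
    by rewrite (bounded_op_lin _ (HA j)) // mulN1r addrC.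
  have HFG : inHn (fun j b => F j b - G j b) by move=> j; exact: inHB.
  apply: le_trans (Ak _ HFG) _.
  apply: (@le_trans _ _ (k * (e / (k + 1)))); first by rewrite ler_wpM2l // ltW.
  rewrite mulrCA ler_piMr ?ltW // ltr_pdivrMr // mul1r; lra.
move=> rF; split.
  by move/rangeE: rF => [f Hf ->] j; exact: inH_bshift.
move=> e e0; exists F; split=> //.
suff -> : normsqn m (fun i a => F i a - F i a) = 0 by [].
rewrite /normsqn big1 // => i _.
have -> : (fun a => F i a - F i a) = fun=> 0 by apply/funext => a; rewrite subrr.
by have := ip_normsq m_gt0 (inH0 R n m); rewrite ip0l //; [case|exact: inH0].
Qed.

(** Since $M_z$ kills $F-M_z^*\delta M_zF$, this vector is orthogonal to the range of $M_z^*$;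
    uniqueness of orthogonal projections identifies the chosen one. *)
Lemma P_ImMz_adjE F : inHn F -> P_ImMz_adj m F = fun i => bshift m i (Mzp m F).
Proof.
move=> HF; pose Q G : Hnsp R n := fun i => bshift m i (Mzp m G).
have rQ G : inHn G -> range (Q G).
  by move=> HG; apply/rangeE; exists (Mzp m G) => //; exact: inH_Mzp.
have rH G : range G -> inHn G.
  by move/rangeE => [f Hf ->] j; exact: inH_bshift.
have QP : is_orth_proj m (closure_Hn m range) Q.
  rewrite closure_rangeE => {F HF} F HF; split; first exact: rQ.
  move=> G /rangeE[f Hf ->].
  have HFQ : inHn (fun i a => F i a - Q F i a).
    by move=> i; apply: inHB => //; exact/rH/rQ.
  rewrite -ip_Mz //.
  have -> : Mz (fun i a => F i a - Q F i a) = fun=> 0; last exact: ip0l.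
  have -> : (fun i a => F i a - Q F i a) = fun i a => (-1) * Q F i a + F i a.
    by apply/funext => i; apply/funext => a; rewrite mulN1r addrC.
  rewrite Mz_lin /Q Mz_bshift_delta; apply/funext => a.
  by rewrite mulN1r addNr.
have : is_orth_proj m (closure_Hn m range) (P_ImMz_adj m).
  by apply: epsilon_spec; exists Q.
move=> PP; rewrite closure_rangeE in QP PP.
have [rP oP] := PP F HF; have [rQF oQ] := QP F HF.
set P := P_ImMz_adj m in rP oP *.
(* The difference of the two projections of [F] lies in the range and is orthogonal to it, hence to
   itself. *)
pose D i a := P F i a - Q F i a.
have rD : range D.
  move/rangeE: rP => [f Hf Pf]; move/rangeE: rQF => [g Hg Qg].
  apply/rangeE; exists (fun a => f a - g a); first exact: inHB.
  by apply/funext => i; apply/funext => a; rewrite /D Pf Qg /bshift; ring.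
have HP := rH _ rP; have HQ := rH _ rQF; have HD := rH _ rD.
have DD : ipn m D D = 0.
  transitivity (ipn m (fun i a => F i a - Q F i a) D - ipn m (fun i a => F i a - P F i a) D).
    rewrite /ipn -sumrB; apply: eq_bigr => i _; rewrite -ipB //; try exact: inHB.
    congr ip; apply/funext => a; rewrite /D; ring.
  by rewrite oQ // oP // subrr.
have D0 i : normsq (D i) = 0.
  have : \sum_i normsq (D i) = 0.
    move: DD; rewrite /ipn (eq_bigr (fun i => ((normsq (D i))%:C)%C)); last first.
      by move=> j _; rewrite ip_normsq.
    by rewrite -rmorph_sum => -[].
  by move/eqP; rewrite psumr_eq0 => [/allP/(_ i (mem_index_enum _))/eqP //|j _]; exact: normsq_ge0.
apply/funext => i; apply/funext => a; apply/eqP; rewrite -subr_eq0.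
by have := normsq_eq0 m_gt0 (HD i) (D0 i) => /(congr1 (fun f => f a)) /= /eqP.
Qed.

End Projection.

(** * Alternating binomial sums and the eigenvalues of $\sigma^j_{M_z}(I)$ *)

Section BinomialSums.
Variable F : numFieldType.

(** Pascal's rule splits the sum in two; recombining lowers the order of the difference by one. *)
Lemma alt_bin_sum_diff (G : nat -> F) p :
  \sum_(j < p.+2) (-1) ^+ j * 'C(p.+1, j)%:R * G j
  = \sum_(j < p.+1) (-1) ^+ j * 'C(p, j)%:R * (G j - G j.+1).
Proof.
rewrite big_ord_recl /= bin0.
under eq_bigr => j _ do rewrite /bump leq0n add1n binS natrD mulrDr mulrDl.
rewrite big_split /= addrA.
have -> : (-1) ^+ 0 * 1%:R * G 0%N + \sum_(j < p.+1) (-1) ^+ j.+1 * 'C(p, j.+1)%:R * G j.+1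
  = \sum_(j < p.+1) (-1) ^+ j * 'C(p, j)%:R * G j.
  transitivity (\sum_(j < p.+2) (-1) ^+ j * 'C(p, j)%:R * G j).
    by rewrite [RHS]big_ord_recl /= bin0.
  by rewrite big_ord_recr /= bin_small // mulr0 mul0r addr0.
rewrite -big_split /=; apply: eq_bigr => j _.
by rewrite exprS; ring.
Qed.

(** By Pascal's rule each difference in $j$ lowers the degree [d] of $j\mapsto\binom{x-j}{d}$ by
    one, and the order [p] exceeds that degree. The bound [p <= x] keeps [x - j] untruncated. *)
Lemma alt_bin_sum_eq0 p d x : (d < p)%N -> (p <= x)%N ->
  \sum_(j < p.+1) (-1) ^+ j * 'C(p, j)%:R * 'C(x - j, d)%:R = 0 :> F.
Proof.
elim: d p x => [|d IHd] [//|p] [//|x] dp px.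
  rewrite (alt_bin_sum_diff (fun j => 'C(x.+1 - j, 0)%:R)) big1 // => j _.
  by rewrite !bin0 subrr mulr0.
rewrite (alt_bin_sum_diff (fun j => 'C(x.+1 - j, d.+1)%:R)) -[RHS](IHd p x) //.
apply: eq_bigr => j _; congr (_ * _).
have jx : (j <= x)%N by apply: leq_trans (_ : p <= x)%N => //; rewrite -ltnS.
by rewrite subSS subSn // binS natrD addrC addKr.
Qed.

(* Eigenvalue of [sigma_{M_z}^j(I)] on the homogeneous polynomials of degree [k]. *)
Fixpoint sigma_eig (m j k : nat) : F :=
  if j is j'.+1 then sigma_eig m j' k.-1 * (k%:R / (m + k - 1)%:R) else 1.

(** With $N=m+k-1$ one factor acts by $\frac kN\binom N{m-1}=\binom{N-1}{m-1}$, so the product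
    telescopes. *)
Lemma sigma_eig_bin m j k : (0 < m)%N -> (j <= m + k - 1)%N ->
  sigma_eig m j k * 'C(m + k - 1, m - 1)%:R = 'C(m + k - 1 - j, m - 1)%:R.
Proof.
move=> m0; elim: j k => [|j IHj] k jk /=; first by rewrite mul1r subn0.
(* Once degree 0 is reached both sides vanish: a factor 0 on the left, an upper index below [m - 1]
   on the right. *)
case: k jk => [|k] jk.
  move: jk; rewrite addn0 => jk.
  by rewrite mul0r mulr0 mul0r bin_small // ltn_subrL /= (leq_trans _ jk).
move: jk; rewrite addnS subSS subn0 /= => jk.
have mk0 : (m + k)%:R != 0 :> F by rewrite pnatr_eq0 -lt0n addn_gt0 m0.
have := mul_bin_down (m + k) (m - 1).
have -> : (m + k - (m - 1) = k.+1)%N.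
  by rewrite subnBA // -addnA addKn addn1.
move/(congr1 (fun x => x%:R : F)); rewrite !natrM => E.
have -> : (m + k - j.+1 = m + k - 1 - j)%N by rewrite -subnDA add1n.
rewrite -IHj; last by rewrite subn1 -ltnS prednK // addn_gt0 m0.
rewrite -mulrA; congr (_ * _); apply: (mulfI mk0).
by rewrite [in RHS]subn1 E mulrA mulrCA mulfV // mulr1.
Qed.

(** Multiplied by the nonzero $\binom{m+k-1}{m-1}$, the sum is the $m$-th difference of
    $\binom{x-j}{m-1}$ with $x=m+k-1$; [0 < k] gives $m\le x$. *)
Lemma alt_sigma_eig_sum m k : (0 < m)%N -> (0 < k)%N ->
  \sum_(j < m.+1) (-1) ^+ j * 'C(m, j)%:R * sigma_eig m j k = 0.
Proof.
move=> m0 k0.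
have B0 : 'C(m + k - 1, m - 1)%:R != 0 :> F.
  by rewrite pnatr_eq0 -lt0n bin_gt0 leq_sub2r // leq_addr.
apply: (mulIf B0); rewrite mul0r mulr_suml.
have mk : (m <= m + k - 1)%N by rewrite -addnBA // leq_addr.
rewrite -[RHS](@alt_bin_sum_eq0 m (m - 1) (m + k - 1)) //; last by rewrite subn1 prednK.
apply: eq_bigr => j _; rewrite -[LHS]mulrA sigma_eig_bin //.
by rewrite (leq_trans _ mk) // -ltnS.
Qed.

End BinomialSums.

(** * Multiplication operators, their commutation with the shifts, and values of $T_h^*$ *)

Section Multiplication.
Variables (R : realType) (n m : nat).
Hypothesis m_gt0 : (0 < m)%N.
Implicit Types (f g h u v w p : Hsp R n) (a b : mi n) (c : R[i]) (i : 'I_n).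
Local Notation inH := (@inH R n m).
Local Notation ip := (@ip R n m).
Local Notation mono := (@mono R n).

(** Any box containing [a] computes the Cauchy product, so coefficients at different indices can be
    compared over one box. *)
Lemma mulHE N u v a : a \in box n N ->
  mulH u v a = \sum_(b <- box n N | [forall i, (b i <= a i)%N]) u b * v (subm a b).
Proof.
move=> aN; rewrite /mulH.
transitivity (\sum_(b <- box n (deg a).+1 | [forall i, (b i <= a i)%N]) u b * v (subm a b)).
  rewrite -big_box; apply: eq_bigl => b.
  by apply: eq_forallb => i; rewrite ffunE.
rewrite -big_filter -[RHS]big_filter; apply: perm_big; apply: uniq_perm.
- exact/filter_uniq/box_uniq.
- exact/filter_uniq/box_uniq.
move=> b; rewrite !mem_filter; case: forallP => //= ba.
have -> : b \in box n (deg a).+1.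
  by rewrite mem_box; apply/forallP => i; rewrite ltnS (leq_trans (ba i)) ?le_deg.
apply/esym; move: aN; rewrite !mem_box => /forallP aN; apply/forallP => i.
exact: leq_ltn_trans (ba i) (aN i).
Qed.

(** For $\alpha_i>0$, the terms with $\beta_i=\alpha_i$ of the product at $\alpha$ vanish; the
    others are those with $\beta\le\alpha-e_i$. *)
Lemma mulH_Mzi i u v : mulH u (Mzi i v) = Mzi i (mulH u v).
Proof.
apply/funext => a; pose N := (deg a).+1.
have aN : a \in box n N by exact: box_deg.
rewrite (mulHE _ _ aN) {2}/Mzi; case: ifPn => a0; last first.
  rewrite big1 // => b _; rewrite /Mzi ffunE.
  by move: a0; rewrite -eqn0Ngt => /eqP ->; rewrite sub0n mulr0.
have sN : sube a i \in box n N by rewrite box_deg // deg_sube // ltnS leq_pred.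
rewrite (mulHE _ _ sN) big_mkcond [RHS]big_mkcond /=; apply: eq_bigr => b _.
rewrite /Mzi ffunE subn_gt0; case: (boolP [forall j, _]) => [/forallP ba|/forallP ba].
  case: ltnP => bi.
    have -> : [forall j, (b j <= sube a i j)%N].
      apply/forallP => j; rewrite ffunE; case: eqP => [->|_]; last exact: ba.
      by rewrite -ltnS prednK.
    congr (_ * v _); apply/ffunP => j; rewrite !ffunE; case: eqP => // ->.
    by rewrite -subn1 -[in RHS]subn1 subnAC.
  rewrite mulr0; case: forallP => // /(_ i); rewrite ffunE eqxx.
  by rewrite -ltnS prednK // ltnNge bi.
case: forallP => // bs; case: ba => j; have := bs j; rewrite ffunE.
by case: eqP => // -> /leq_trans -> //; exact: leq_pred.
Qed.

Lemma mulH_sum (I : Type) (s : seq I) (c : I -> R[i]) (V : I -> Hsp R n) u a :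
  mulH u (fun b => \sum_(j <- s) c j * V j b) a = \sum_(j <- s) c j * mulH u (V j) a.
Proof.
rewrite /mulH; under eq_bigr => b _ do rewrite mulr_sumr.
rewrite exchange_big /=; apply: eq_bigr => j _; rewrite mulr_sumr.
by apply: eq_bigr => b _; ring.
Qed.

(** Monomials lie in the domain of $T_u$: $z^\alpha u$ arises from [u] by $|\alpha|$ bounded
    shifts. *)
Lemma inH_mulH_mono u a : inH u -> inH (mulH u (mono a)).
Proof.
move=> Hu; have [k ka] : exists k, deg a = k by exists (deg a).
elim: k a ka => [|k IHk] a ka.
  have a0 i : a i = 0%N by apply/eqP; rewrite -leqn0 -ka le_deg.
  suff -> : mulH u (mono a) = u by [].
  apply/funext => b; have bN : b \in box n (deg b).+1 by exact: box_deg.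
  rewrite (mulHE _ _ bN) big_mkcond (bigD1_seq b) ?box_uniq //= ifT; last by apply/forallP.
  rewrite big1 ?addr0; last first.
    move=> b' b'Nb; case: ifP => // /forallP b'b; rewrite /mono.
    case: eqP => [E|_]; last by rewrite mulr0.
    case/eqP: b'Nb; apply/ffunP => i; apply/eqP; rewrite eqn_leq b'b /=.
    by rewrite -subn_eq0 -(a0 i) -E ffunE.
  rewrite /mono; case: eqP => [_|[]]; first by rewrite mulr1.
  by apply/ffunP => i; rewrite ffunE a0 subnn.
have [i ai] : exists i, (0 < a i)%N.
  apply/existsP; apply: contra_eqT ka => /existsPn a0; rewrite /deg big1 // => i _.
  by apply/eqP; rewrite eqn0Ngt a0.
rewrite -(subeK ai) -Mzi_mono mulH_Mzi; apply: bounded_opH; first exact: bounded_op_Mzi.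
by apply: IHk; rewrite deg_sube // ka.
Qed.

(** Testing against monomials, which lie in the domain of $T_h$, determines a value of $T_h^*$. *)
Lemma is_Tu_adj_val_unique h p v w : inH h ->
  is_Tu_adj_val m h p v -> is_Tu_adj_val m h p w -> v = w.
Proof.
move=> Hh [Hp [Hv vP]] [_ [Hw wP]]; apply: (ip_mono_inj m_gt0) => // a.
by rewrite -vP -?wP //; split; (exact: inH_mono || exact: inH_mulH_mono).
Qed.

(** The adjoint form of [mulH_Mzi]: $M_{z_i}$ preserves the domain of $T_h$ and commutes with
    $T_h$. *)
Lemma is_Tu_adj_val_bshift i h p w :
  is_Tu_adj_val m h p w -> is_Tu_adj_val m h (bshift m i p) (bshift m i w).
Proof.
move=> [Hp [Hw wP]]; split; first exact: inH_bshift.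
split; first exact: inH_bshift.
move=> x [Hx Hhx]; rewrite -ip_Mzi // -mulH_Mzi wP ?ip_Mzi //; split.
  by apply: bounded_opH Hx; exact: bounded_op_Mzi.
by rewrite mulH_Mzi; apply: bounded_opH Hhx; exact: bounded_op_Mzi.
Qed.

Lemma is_poly_bshift i p : is_poly p -> is_poly (bshift m i p).
Proof.
move=> [N pN]; exists N => a aN; rewrite /bshift pN ?mulr0 //.
by rewrite deg_adde (leq_trans aN).
Qed.

End Multiplication.

(** * The iterates $\sigma^j_{M_z}(T)$ and their alternating sum *)

Section PluriharmonicToeplitz.
Variables (R : realType) (n m : nat).
Hypothesis m_gt0 : (0 < m)%N.
Variables (T : Hsp R n -> Hsp R n) (g h : Hsp R n).
Hypothesis T_toeplitz : toeplitz_pluriharmonic m T g h.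
Implicit Types (f u v w p : Hsp R n) (a b : mi n) (c : R[i]) (i : 'I_n).
Local Notation inH := (@inH R n m).
Local Notation bounded_op := (@bounded_op R n m).
Local Notation mono := (@mono R n).
Local Notation eig := (sigma_eig (R[i]) m).

(** On polynomials this is $T_h^*p$, obtained by subtraction so as to be a function of [p]. *)
Definition coanalytic_part p : Hsp R n :=
  fun a => T p a - mulH g p a.

Lemma coanalytic_part_val p : is_poly p -> is_Tu_adj_val m h p (coanalytic_part p).
Proof.
move=> /T_toeplitz.2.2.2[w [wP Tp]].
suff -> : coanalytic_part p = w by [].
by apply/funext => a; rewrite /coanalytic_part Tp addrC addKr.
Qed.

Lemma coanalytic_part_bshift i p : is_poly p ->
  coanalytic_part (bshift m i p) = bshift m i (coanalytic_part p).
Proof.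
move=> pP; apply: (is_Tu_adj_val_unique m_gt0 T_toeplitz.2.2.1 (coanalytic_part_val _)).
  exact: is_poly_bshift.
exact/is_Tu_adj_val_bshift/coanalytic_part_val.
Qed.

(* The operator [sigma_{M_z}^j(I)]. *)
Definition sigma_id j f : Hsp R n := fun a => eig j (deg a) * f a.

(** $M_{z_i}$ raises the degree by one, so the eigenvalue of $\sigma^j(I)$ is met in degree $k-1$;
    $M_zM_z^*$ supplies the factor $k/(m+k-1)$. *)
Lemma sigma_idS j f : (fun a => \sum_i Mzi i (sigma_id j (bshift m i f)) a) = sigma_id j.+1 f.
Proof.
apply/funext => a; rewrite /sigma_id /= -mulrA -Mz_bshift // /Mz mulr_sumr.
apply: eq_bigr => i _; rewrite /Mzi; case: ifPn => a0; last by rewrite mulr0.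
by rewrite deg_sube.
Qed.

(** Induction on [j] for all polynomials at once, since the step replaces [p] by $M_{z_i}^*p$;
    $M_{z_i}$ moves past $T_g$ and $M_{z_i}^*$ past $T_h^*$. *)
Lemma iter_sigma_poly j p : is_poly p ->
  iter j (sigmaMz m) T p = fun a => mulH g (sigma_id j p) a + sigma_id j (coanalytic_part p) a.
Proof.
elim: j p => [|j IHj] p pP.
  have E0 f : sigma_id 0 f = f by apply/funext => a; rewrite /sigma_id mul1r.
  by rewrite !E0; apply/funext => a; rewrite /coanalytic_part addrC subrK.
apply/funext => a; rewrite iterS /sigmaMz -!sigma_idS.
have -> : mulH g (fun b => \sum_i Mzi i (sigma_id j (bshift m i p)) b) a
   = \sum_i Mzi i (mulH g (sigma_id j (bshift m i p))) a.
  under [in LHS]eq_fun => b do under eq_bigr => i _ do rewrite -[Mzi _ _ _]mul1r.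
  by rewrite mulH_sum; apply: eq_bigr => i _; rewrite mul1r mulH_Mzi.
rewrite -big_split /=; apply: eq_bigr => i _; rewrite Mzi_adjE //; last exact: inH_poly.
rewrite IHj; last exact: is_poly_bshift.
by rewrite coanalytic_part_bshift // /Mzi; case: ifP => // _; rewrite addr0.
Qed.

Lemma bounded_op_iter_sigma j : bounded_op (iter j (sigmaMz m) T).
Proof.
elim: j => [|j IHj]; first exact: T_toeplitz.1.
(* [Mzi_adj] is known only on the space, so boundedness is proved for the explicit shift and
   transported. *)
apply: (@bounded_op_eq _ _ _ m_gt0 (fun f a =>
  \sum_i 1 * Mzi i (iter j (sigmaMz m) T (bshift m i f)) a)).
  move=> f Hf; apply/funext => a; apply: eq_bigr => i _.
  by rewrite mul1r Mzi_adjE.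
apply: (bounded_op_sum m_gt0) => i; apply: bounded_op_comp; first exact: bounded_op_Mzi.
by apply: bounded_op_comp => //; exact: bounded_op_bshift.
Qed.

(** By density it suffices to take nonconstant monomials $z^a$. There the $T_g$ part vanishes by the
    eigenvalue identity in degree $|a|$, and the $T_h^*$ part by the one in degree $|b|$. *)
Lemma alt_sigma_eq0 f b : inH f -> (forall a, deg a = 0%N -> f a = 0) -> deg b != 0%N ->
  \sum_(j < m.+1) ((-1) ^+ j * 'C(m, j)%:R) * iter j (sigmaMz m) T f b = 0.
Proof.
move=> Hf f0 b0.
apply: (coef_functional_eq0 m_gt0 (A := fun f b => \sum_(j < m.+1)
   ((-1) ^+ j * 'C(m, j)%:R) * iter j (sigmaMz m) T f b)) => //.
  by apply: bounded_op_sum => // j; exact: bounded_op_iter_sigma.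
move=> a fa; have a0 : (0 < deg a)%N.
  by rewrite lt0n; apply: contra_neqN fa => /eqP /f0.
have sE (j : 'I_m.+1) : true ->
    (-1) ^+ j * 'C(m, j)%:R * iter j (sigmaMz m) T (mono a) b
    = (-1) ^+ j * 'C(m, j)%:R * mulH g (sigma_id j (mono a)) b
      + (-1) ^+ j * 'C(m, j)%:R * sigma_id j (coanalytic_part (mono a)) b.
  by rewrite iter_sigma_poly ?mulrDr //; exact: mono_poly.
rewrite (eq_bigr _ sE) big_split /= -mulH_sum.
have -> : (fun b => \sum_(j < m.+1) (-1) ^+ j * 'C(m, j)%:R * sigma_id j (mono a) b) = fun=> 0.
  apply/funext => a'; rewrite /sigma_id /mono.
  case: eqP => [->|_]; last by rewrite big1 // => j _; rewrite !mulr0.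
  by under eq_bigr do rewrite mulr1; rewrite alt_sigma_eig_sum.
rewrite /mulH big1 ?add0r => [|? _]; last by rewrite mulr0.
rewrite /sigma_id; under eq_bigr => j _ do rewrite mulrA.
by rewrite -mulr_suml alt_sigma_eig_sum ?mul0r // lt0n.
Qed.

Lemma bounded_op_Sop : bounded_op (Sop m T).
Proof. by apply: bounded_op_sum => // j; exact: bounded_op_iter_sigma. Qed.

(* [sigma_{M_z}(S) = T] off the constants, [S] the alternating sum of the theorem. *)
Lemma Mz_Sop_bshift f b : inH f -> (forall a, deg a = 0%N -> f a = 0) -> deg b != 0%N ->
  Mz (fun i => Sop m T (bshift m i f)) b = T f b.
Proof.
move=> Hf f0 b0; have := alt_sigma_eq0 Hf f0 b0.
(* The term [j = 0] is [T f b]; the others, shifted by one and moved across, carry the signs and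
   coefficients $\binom m{j+1}$ of [Sop]. *)
rewrite big_ord_recl /= bin0 expr0 !mul1r => /eqP; rewrite addr_eq0 => /eqP ->.
rewrite -sumrN.
transitivity (\sum_(j < m) ((-1) ^+ j * 'C(m, j.+1)%:R) * iter j.+1 (sigmaMz m) T f b).
  rewrite /Mz /Sop.
  transitivity (\sum_(i < n) \sum_(j < m) ((-1) ^+ j * 'C(m, j.+1)%:R)
      * Mzi i (iter j (sigmaMz m) T (bshift m i f)) b).
    apply: eq_bigr => i _; rewrite /Mzi; case: ifP => // _.
    by rewrite big1 // => j _; rewrite mulr0.
  rewrite exchange_big /=; apply: eq_bigr => j _; rewrite -mulr_sumr; congr (_ * _).
  by apply: eq_bigr => i _; rewrite Mzi_adjE.
apply: eq_bigr => j _; rewrite /bump leq0n add1n exprS add0n -iterS; ring.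
Qed.

End PluriharmonicToeplitz.

(** * Assembly of the operator identity from the explicit adjoint and projection *)

Theorem theorem5 (R : realType) (n m : nat) (hn : (1 <= n)%N) (hm : (1 <= m)%N)
  (g h : Hsp R n) (T : Hsp R n -> Hsp R n) :
  inH m g -> inH m h -> bounded_op m T ->
  toeplitz_pluriharmonic m T g h ->
  forall F : Hnsp R n, inHn m F ->
    Mzp_adj m (T (Mzp m F)) =
    P_ImMz_adj m (oplus (Sop m T) (P_ImMz_adj m F)).
Proof.
move=> _ _ TB TT F HF; have Hf := inH_Mzp hm HF.
rewrite Mzp_adjE //; last exact: bounded_opH TB Hf.
rewrite (P_ImMz_adjE hm HF) P_ImMz_adjE //; last first.
  move=> i; apply: bounded_opH; first exact: bounded_op_Sop TT.
  exact: inH_bshift.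
(* Both sides are now $M_z^*\delta$ of a vector, and at [a] the shift reads only the coefficient at
   $a+e_i$, of positive degree. There $M_z(\oplus S)M_z^*$, with $S$ the operator [Sop m T], agrees
   with [T] on [Mzp m F], which has no constant term. *)
apply/funext => i; apply/funext => a; rewrite /bshift; congr (_ * _).
rewrite {2}/Mzp !deltaE /oplus; congr (_ * _).
rewrite (Mz_Sop_bshift hm TT) //; last by rewrite deg_adde.
by move=> b b0; rewrite /Mzp deltaE Mz_deg0 // mulr0.
Qed.
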